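(* Let $k$ and $m_1,\ldots,m_n$ be positive integers, let $\tau=1^{m_1}\text{-}1^{m_2}\text{-}\cdots\text{-}1^{m_n}$, and let $A$ be the set of $k$-ary words (words on $\{1,\ldots,k\}$, including the empty word) avoiding $\tau$. Then \[ \sum_{a_1\cdots a_l\in A} x_{a_1}x_{a_2}\cdots x_{a_l} = \Phi\left(\prod_{i=1}^k\Big[e^{tx_i} - T\big\{G_\tau(x_i,u)\big\}\Big]\right), \] where \[ G_\tau(x,u)=\frac{ux^{m_1}(1-x)}{(1-x-u(x-x^{m_1}))(1-x-ux)}\prod_{i=2}^n\left[x^{m_i}+\frac{ux^{m_i}(1-x^{m_i})}{1-x-u(x-x^{m_i})}\right]. \]
   Context: A word $W=s_1\cdots s_l$ contains the vincular pattern $\tau=1^{m_1}\text{-}\cdots\text{-}1^{m_n}$ (with $M=m_1+\cdots+m_n$) if there are indices $1\le i_1<\cdots<i_M\le l$ with $s_{i_1}=\cdots=s_{i_M}$ and $i_{j+1}-i_j=1$ for all $j\notin\{m_1,m_1+m_2,\ldots,m_1+\cdots+m_{n-1}\}$; i.e. $M$ equal letters of which the first $m_1$ are consecutive, the next $m_2$ are consecutive, etc. Otherwise $W$ avoids $\tau$. The polynomials $l_k(t)$ are defined by $\sum_{k\ge0}l_k(t)y^k=e^{ty/(1+y)}$ (so $l_k(t)=(-1)^kL_k^{(-1)}(t)$ with $L_k^{(\alpha)}$ the generalized Laguerre polynomials). $T$ is the linear map sending $u^k\mapsto l_k(t)$, applied coefficientwise to power series in $u$ whose coefficients are power series in the variables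 $x_i$ (expanding $G_\tau(x,u)$ as a power series in $u$ and $x$). $\Phi$ is the linear map with $\Phi(t^j)=j!$ fixing all other variables, applied coefficientwise to power series in the $x_i$ whose coefficients are polynomials in $t$. *)

(* Defs.v *)
From HB Require Import structures.
From mathcomp Require Import all_boot all_order all_algebra.
Set Implicit Arguments. Unset Strict Implicit. Unset Printing Implicit Defensive.
Import Order.TTheory GRing.Theory Num.Theory.
Local Open Scope ring_scope.

(* Vincular pattern containment  tau = 1^{m_1}-1^{m_2}-...-1^{m_n}     *)
(* given by ms = [:: m_1; ...; m_n].  Indices are 0-based: a tuple idx *)
(* of M = m_1+...+m_n positions of w, strictly increasing, carrying    *)
(* equal letters, and consecutive (idx_{j+1} = idx_j + 1) unless j+1   *)
(* (the 1-based index j of the paper) is a block boundary              *)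
(* m_1, m_1+m_2, ..., m_1+...+m_{n-1}.                                 *)
Definition block_bounds (ms : seq nat) : seq nat :=
  [seq sumn (take r ms) | r <- iota 1 (size ms).-1].

Definition contains_pat (ms : seq nat) (T : eqType) (w : seq T) : bool :=
  [exists idx : (sumn ms).-tuple 'I_(size w),
    let s := [seq nat_of_ord i | i <- idx] in
    [&& sorted ltn s,
        [forall j1 : 'I_(sumn ms), forall j2 : 'I_(sumn ms),
           tnth (in_tuple w) (tnth idx j1) == tnth (in_tuple w) (tnth idx j2)] &
        [forall j : 'I_(sumn ms),
           ((j.+1 < sumn ms)%N && (j.+1 \notin block_bounds ms)) ==>
             (nth 0%N s j.+1 == (nth 0%N s j).+1)]]].

Definition avoids_pat (ms : seq nat) (T : eqType) (w : seq T) : bool :=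
  ~~ contains_pat ms w.

(* Univariate formal power series over a commutative ring, as          *)
(* coefficient functions  nat -> R.                                    *)
Section Ser.
Variable R : comNzRingType.

Definition sone : nat -> R := fun n => (n == 0)%:R.
Definition sX : nat -> R := fun n => (n == 1)%:R.
Definition sXn (m : nat) : nat -> R := fun n => (n == m)%:R.
Definition sconst (c : R) : nat -> R := fun n => if n == 0 then c else 0.
Definition sadd (f g : nat -> R) : nat -> R := fun n => f n + g n.
Definition ssub (f g : nat -> R) : nat -> R := fun n => f n - g n.
Definition smul (f g : nat -> R) : nat -> R :=
  fun n => \sum_(i < n.+1) f i * g (n - i)%N.
Definition spow (f : nat -> R) (j : nat) : nat -> R := iter j (smul f) sone.
Definition sprod (fs : seq (nat -> R)) : nat -> R := foldr smul sone fs.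
(* 1/(1 - s) for s with zero constant term (the sum is then exact). *)
Definition sgeom (s : nat -> R) : nat -> R :=
  fun n => \sum_(j < n.+1) spow s j n.
(* multiplicative inverse of a series f with constant term 1 *)
Definition sinv (f : nat -> R) : nat -> R := sgeom (ssub sone f).
End Ser.
Arguments sone {R}.
Arguments sX {R}.
Arguments sXn {R}.

(* exp(s) for a series s (zero constant term) over Q[t] *)
Definition sexp (s : nat -> {poly rat}) : nat -> {poly rat} :=
  fun n => \sum_(j < n.+1) ((j`!)%:R^-1 : rat) *: spow s j n.

(* G_tau(x,u), expanded as a power series in x whose coefficients are  *)
(* polynomials in u (u is the polynomial variable 'X of {poly rat}).    *)
Definition sU : nat -> {poly rat} := sconst 'X.

Definition denA (m : nat) : nat -> {poly rat} :=
  ssub (ssub sone sX) (smul sU (ssub sX (sXn m))).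
Definition denB : nat -> {poly rat} := ssub (ssub sone sX) (smul sU sX).

Definition Gfactor (m : nat) : nat -> {poly rat} :=
  sadd (sXn m)
       (smul (smul (smul sU (sXn m)) (ssub sone (sXn m))) (sinv (denA m))).

Definition Gtau (ms : seq nat) : nat -> {poly rat} :=
  match ms with
  | [::] => fun _ => 0
  | m1 :: rest =>
      smul (smul (smul (smul (smul sU (sXn m1)) (ssub sone sX))
                       (sinv (denA m1)))
                 (sinv denB))
           (sprod [seq Gfactor m | m <- rest])
  end.

(* l_k(t): sum_k l_k(t) y^k = exp(t y / (1 + y)); t is 'X of {poly rat} *)
Definition lpoly : nat -> {poly rat} :=
  sexp (smul (sconst 'X) (smul sX (sinv (sadd sone sX)))).

Definition Tmap (p : {poly rat}) : {poly rat} :=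
  \sum_(j < size p) p`_j *: lpoly j.

Definition Phi (p : {poly rat}) : rat :=
  \sum_(j < size p) p`_j * (j`!)%:R.

Definition etx : nat -> {poly rat} := sexp (smul (sconst 'X) sX).

Definition Ffactor (ms : seq nat) (a : nat) : {poly rat} :=
  etx a - Tmap (Gtau ms a).

(* Main.v *)
Require Import Defs.
From HB Require Import structures.
From Stdlib Require Import Setoid Morphisms Ring.
From mathcomp Require Import all_boot all_order all_algebra zify.
Import Order.TTheory GRing.Theory Num.Theory.
Set Implicit Arguments. Unset Strict Implicit. Unset Printing Implicit Defensive.
Local Open Scope ring_scope.

(* For a letter x, record at each occurrence of x in a word whether it starts
   a new run.  Whether x forms the pattern depends only on this flag string,
   and [G_tau] counts the strings accepted by greedy matching, with u marking
   the runs.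

   The map T satisfies T(u p)' = T p - (T p)', because l_{k+1}' = l_k - l_k'.
   Together with the integration by parts Phi p = p(0) + Phi p' this turns
   Phi (prod_i T p_i) into a sum over the first letter of a word, which is the
   recursion for the number of words whose flag strings satisfy prescribed
   conditions.  Here a letter equal to the preceding one contributes
   (1 - d/dt) T p, where p also allows its current run to go on, and every
   other letter contributes T p with p restricted to strings opening a run. *)

(** * The ring of formal power series *)

Section SeriesRing.
Variable R : comNzRingType.
Implicit Types f g s : nat -> R.

Definition szero : nat -> R := fun _ => 0.
Definition sopp f : nat -> R := fun n => - f n.
Definition series_eq : relation (nat -> R) := fun f g => f =1 g.

(** A coefficient of a product only sees truncations, so the ring laws of series are inherited from
    polynomials. *)
Lemma smul_trunc N f g n : (n < N)%N ->
  smul f g n = ((\poly_(i < N) f i) * (\poly_(i < N) g i))`_n.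
Proof.
move=> nN; rewrite coefM; apply: eq_bigr => i _.
have iN : (i < N)%N by exact: leq_ltn_trans (leq_ord i) nN.
by rewrite !coef_poly iN (leq_ltn_trans (leq_subr _ _) nN).
Qed.

Lemma eq_smul f f' g g' : f =1 f' -> g =1 g' -> smul f g =1 smul f' g'.
Proof. by move=> ef eg n; apply: eq_bigr => i _; rewrite ef eg. Qed.

Lemma smulC f g : smul f g =1 smul g f.
Proof. by move=> n; rewrite !(@smul_trunc n.+1) // mulrC. Qed.

Lemma smulA f g h : smul f (smul g h) =1 smul (smul f g) h.
Proof.
move=> n; set P := fun f => \poly_(i < n.+1) f i.
have in1 (i : 'I_n.+1) : (i < n.+1)%N by [].
transitivity ((P f * (P g * P h))`_n).
  rewrite coefM; apply: eq_bigr => i _.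
  by rewrite coef_poly in1 -smul_trunc // ltnS leq_subr.
rewrite mulrA coefM; apply: eq_bigr => i _.
by rewrite -smul_trunc // coef_poly ltnS leq_subr.
Qed.

Lemma smul1f f : smul sone f =1 f.
Proof.
move=> n; rewrite /smul big_ord_recl /sone eqxx mul1r subn0 big1 ?addr0 // => i _.
by rewrite mul0r.
Qed.

Lemma smulDl f g h : smul (sadd f g) h =1 sadd (smul f h) (smul g h).
Proof.
by move=> n; rewrite /smul /sadd -big_split; apply: eq_bigr => i _; rewrite mulrDl.
Qed.

Lemma series_ring_theory :
  ring_theory szero sone (@sadd R) (@smul R) (@ssub R) sopp series_eq.
Proof.
split=> [f|f g|f g h|f|f g|f g h|f g h|f g|f] //.
- by move=> n; rewrite /sadd add0r.
- by move=> n; rewrite /sadd addrC.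
- by move=> n; rewrite /sadd addrA.
- exact: smul1f.
- exact: smulC.
- exact: smulA.
- exact: smulDl.
- by move=> n; rewrite /sadd /sopp subrr.
Qed.

Lemma series_eq_equiv : Equivalence series_eq.
Proof.
by split=> [f|f g fg|f g h fg gh] n //; rewrite fg.
Qed.

Lemma series_eq_ext : ring_eq_ext (@sadd R) (@smul R) sopp series_eq.
Proof.
split.
- by move=> f f' ef g g' eg n; rewrite /sadd ef eg.
- by move=> f f' ef g g' eg; apply: eq_smul.
- by move=> f f' ef n; rewrite /sopp ef.
Qed.

(** Each factor [s] raises the order by at least one. Hence the finite cutoffs in [sgeom] and [sexp]
    lose nothing and may be enlarged. *)
Lemma spow_eq0 s j n : s 0%N = 0 -> (n < j)%N -> spow s j n = 0.
Proof.
move=> s0; elim: j n => // j IHj n nj; rewrite [LHS]big1 // => -[i /= ilt] _.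
case: i ilt => [|i] ilt; first by rewrite s0 mul0r.
have ij : (n - i.+1 < j)%N by lia.
by rewrite [X in _ * X](IHj _ ij) mulr0.
Qed.

Lemma smul_sum f (F : nat -> nat -> R) N n :
  smul f (fun m => \sum_(j < N) F j m) n = \sum_(j < N) smul f (F j) n.
Proof. by rewrite exchange_big; apply: eq_bigr => i _; rewrite mulr_sumr. Qed.

Lemma sgeomE s N n : s 0%N = 0 -> (n < N)%N ->
  sgeom s n = \sum_(j < N) spow s j n.
Proof.
move=> s0 nN; rewrite /sgeom (big_ord_widen N (fun j => spow s j n)) //.
rewrite big_mkcond; apply: eq_bigr => j _; case: ltnP => // nj.
by rewrite spow_eq0.
Qed.

Lemma sgeomK s : s 0%N = 0 -> smul (ssub sone s) (sgeom s) =1 sone.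
Proof.
move=> s0 n.
have -> : smul (ssub sone s) (sgeom s) n = sgeom s n - smul s (sgeom s) n.
  rewrite -[in RHS](smul1f (sgeom s)) /smul -sumrB.
  by apply: eq_bigr => i _; rewrite mulrBl.
have -> : smul s (sgeom s) n = smul s (fun m => \sum_(j < n.+1) spow s j m) n.
  by apply: eq_bigr => i _; rewrite (@sgeomE _ n.+1) // ltnS leq_subr.
(* The cutoffs differ by one so that all powers of [s] cancel except the zeroth. *)
rewrite smul_sum (@sgeomE _ n.+2) // big_ord_recl /= -addrA.
by rewrite subrr addr0.
Qed.

Lemma smul_sinv f : f 0%N = 1 -> smul f (sinv f) =1 sone.
Proof.
move=> f0 n; rewrite -(@sgeomK (ssub sone f)); last by rewrite /ssub /sone f0 subrr.
by apply: eq_smul => // m; rewrite /ssub opprB addrC subrK.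
Qed.
End SeriesRing.

(** * The operators T and Phi *)

Lemma smul_sX (R : comNzRingType) (f : nat -> R) n :
  smul sX f n = if n is n'.+1 then f n' else 0.
Proof.
rewrite /smul /sX big_ord_recl mul0r add0r; case: n => [|n]; first by rewrite big_ord0.
rewrite big_ord_recl mul1r big1 ?addr0 // => [|i _]; first by rewrite subn1.
by rewrite mul0r.
Qed.

Lemma smul_sconst (R : comNzRingType) (c : R) f n : smul (sconst c) f n = c * f n.
Proof.
by rewrite /smul big_ord_recl subn0 big1 ?addr0 // => i _; rewrite mul0r.
Qed.

Lemma spow_sconst (R : comNzRingType) (c : R) f j n :
  spow (smul (sconst c) f) j n = c ^+ j * spow f j n.
Proof.
elim: j n => [|j IHj] n; first by rewrite mul1r.
have -> : spow (smul (sconst c) f) j.+1 n =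
   smul (smul (sconst c) f) (fun m => c ^+ j * spow f j m) n by exact: eq_smul.
rewrite -smulA smul_sconst exprS -mulrA; congr (_ * _).
by rewrite mulr_sumr; apply: eq_bigr => i _; rewrite mulrCA.
Qed.

Section ConstantSeries.
Variable R : comNzRingType.
Implicit Types f g : nat -> {poly R}.

(** Independence of t, phrased in the form in which differentiation uses it. *)
Definition constant_series f := forall n, (f n)^`() = 0.

Lemma constant_smul f g :
  constant_series f -> constant_series g -> constant_series (smul f g).
Proof.
move=> cf cg n; rewrite raddf_sum big1 // => i _ /=.
by rewrite derivM cf cg mul0r mulr0 addr0.
Qed.

Lemma constant_sone : constant_series sone.
Proof. by move=> n; rewrite /sone -polyC_natr derivC. Qed.

Lemma constant_sX : constant_series sX.
Proof. by move=> n; rewrite /sX -polyC_natr derivC. Qed.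

Lemma constant_spow f j : constant_series f -> constant_series (spow f j).
Proof.
move=> cf; elim: j => [|j IHj]; [exact: constant_sone | exact: constant_smul].
Qed.

Lemma constant_sinv f : constant_series f -> constant_series (sinv f).
Proof.
move=> cf n; rewrite raddf_sum big1 // => j _; apply: constant_spow => m.
by rewrite derivB cf constant_sone subr0.
Qed.
End ConstantSeries.

Lemma coef0_spow0 (z : nat -> {poly rat}) n j :
  (('X ^+ j * spow z j n.+1).[0] = 0).
Proof. case: j => [|j]; first by rewrite mulr0 horner0.
by rewrite exprS -mulrA hornerM hornerX mul0r. Qed.

Lemma sexp_X0 (z : nat -> {poly rat}) n : (sexp (smul (sconst 'X) z) n.+1).[0] = 0.
Proof.
rewrite /sexp -horner_evalE raddf_sum big1 //= => j _.
by rewrite horner_evalE hornerZ spow_sconst coef0_spow0 mulr0.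
Qed.

Lemma sexp_0 (s : nat -> {poly rat}) : sexp s 0 = 1.
Proof. by rewrite /sexp big_ord1 fact0 invr1 scale1r. Qed.

Lemma sexp_Xle (z : nat -> {poly rat}) n N : z 0%N = 0 -> (n < N)%N ->
  sexp (smul (sconst 'X) z) n = 
  \sum_(j < N) ((j`!)%:R^-1 : rat) *: ('X ^+ j * spow z j n).
Proof.
move=> z0 nN; rewrite /sexp.
under eq_bigr do rewrite spow_sconst.
rewrite (big_ord_widen N (fun j => (j`!)%:R^-1 *: ('X ^+ j * spow z j n))) //.
rewrite big_mkcond; apply: eq_bigr => j _; case: ltnP => // nj.
by rewrite spow_eq0 // mulr0 scaler0.
Qed.

(** This is d/dt exp(tz) = z exp(tz) for z free of t; the term [j = 0] drops out and the index
    shifts by one. *)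
Lemma deriv_sexp (z : nat -> {poly rat}) n N : constant_series z -> z 0%N = 0 ->
  (n <= N)%N ->
  (sexp (smul (sconst 'X) z) n)^`() =
  \sum_(j < N) ((j`!)%:R^-1 : rat) *: ('X ^+ j * spow z j.+1 n).
Proof.
move=> cz z0 nN; rewrite (@sexp_Xle _ n N.+1) // raddf_sum big_ord_recl.
rewrite [X in X + _](_ : _ = 0) ?add0r; last first.
  by rewrite /= derivZ mul1r constant_sone scaler0.
apply: eq_bigr => j _.
rewrite lift0 [LHS]derivZ derivM derivXn (constant_spow _ cz).
rewrite mulr0 addr0 /= mulrnAl -scaler_nat scalerA; congr (_ *: _).
by rewrite factS natrM invfM mulrAC mulVf ?mul1r // pnatr_eq0.
Qed.

(** For z = y/(1+y) one has (1+y)z = y, so (1+y) d/dt exp(tz) = y exp(tz); compare coefficients of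
    y^(n+1). *)
Lemma deriv_lpoly n : (lpoly n.+1)^`() = lpoly n - (lpoly n)^`().
Proof.
rewrite /lpoly; set z := smul sX _.
have z0 : z 0%N = 0 by rewrite /z smul_sX.
have cz : constant_series z.
  apply: constant_smul; first exact: constant_sX.
  apply: constant_sinv => m; rewrite derivD constant_sone constant_sX addr0 //.
have zE : smul (sadd sone sX) z =1 sX.
  move=> m; have eC : smul (sadd sone sX) sX =1 smul sX (sadd sone sX) :> (nat -> {poly rat}).
    exact: smulC.
  rewrite /z smulA (eq_smul eC (frefl _)) -smulA.
  rewrite (eq_smul (frefl _) (smul_sinv _)); last by rewrite /sadd /sone /sX addr0.
  by rewrite smulC smul1f.
have zS j m : spow z j.+1 m.+1 + spow z j.+1 m = spow z j m.
  transitivity (smul (smul (sadd sone sX) z) (spow z j) m.+1).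
    rewrite -smulA smulDl /sadd smul1f smul_sX //.
  by rewrite (eq_smul zE (frefl _)) smul_sX.
rewrite !(@deriv_sexp _ _ n.+1) // (@sexp_Xle _ n n.+1) // -sumrB; apply: eq_bigr => j _.
by rewrite -scalerBr -mulrBr -(zS j n) addrK.
Qed.

Lemma TmapE (p : {poly rat}) N : (size p <= N)%N -> Tmap p = \sum_(j < N) p`_j *: lpoly j.
Proof.
move=> pN; rewrite /Tmap (big_ord_widen N (fun j => p`_j *: lpoly j)) //.
rewrite big_mkcond; apply: eq_bigr => j _; case: ltnP => // nj.
by rewrite nth_default // scale0r.
Qed.

Lemma Tmap_is_linear : linear Tmap.
Proof.
move=> a p q; set N := maxn (size p) (size q).
rewrite !(@TmapE _ N) ?leq_maxl ?leq_maxr //; last first.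
  rewrite (leq_trans (size_polyD _ _)) // geq_max leq_maxr andbT.
  by rewrite (leq_trans (size_scale_leq _ _)) // leq_maxl.
rewrite scaler_sumr -big_split; apply: eq_bigr => j _ /=.
by rewrite coefD coefZ scalerDl scalerA.
Qed.
HB.instance Definition _ :=
  GRing.isLinear.Build rat {poly rat} {poly rat} *:%R Tmap Tmap_is_linear.

Lemma TmapC (c : rat) : Tmap c%:P = c%:P.
Proof.
by rewrite (@TmapE _ 1) ?size_polyC_leq1 // big_ord1 coefC /lpoly sexp_0 alg_polyC.
Qed.

Lemma Tmap_XE p : Tmap ('X * p) = \sum_(j < size p) p`_j *: lpoly j.+1.
Proof.
rewrite (@TmapE _ (size p).+1); last first.
  by rewrite (leq_trans (size_polyMleq _ _)) // size_polyX.
rewrite big_ord_recl coefXM scale0r add0r; apply: eq_bigr => j _.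
by rewrite lift0 coefXM.
Qed.

Lemma deriv_TmapX p : (Tmap ('X * p))^`() = Tmap p - (Tmap p)^`().
Proof.
rewrite Tmap_XE /Tmap !raddf_sum /= -big_split; apply: eq_bigr => j _.
by rewrite /= !derivZ deriv_lpoly scalerBr.
Qed.

Lemma TmapX0 p : (Tmap ('X * p)).[0] = 0.
Proof.
rewrite Tmap_XE -horner_evalE raddf_sum big1 //= => j _.
by rewrite horner_evalE hornerZ /lpoly sexp_X0 mulr0.
Qed.

Lemma poly_deriv_inj (p q : {poly rat}) : p^`() = q^`() -> p.[0] = q.[0] -> p = q.
Proof.
move=> epq e0; apply/polyP => -[|i]; first by rewrite -!horner_coef0.
have := congr1 (fun r : {poly rat} => r`_i) epq; rewrite !coef_deriv.
by move/eqP; rewrite eqr_pMn2r // => /eqP.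
Qed.

(** The polynomial u(1+u)^n enumerates all flag strings of length n+1 that open a run, so [etx]
    stands for unrestricted occurrences of a letter. Both sides vanish at t = 0, and their
    derivatives agree by induction. *)
Lemma etxE n : etx n.+1 = Tmap ('X * (1 + 'X) ^+ n).
Proof.
have dE m : (etx m.+1)^`() = etx m.
  rewrite /etx (@deriv_sexp _ _ m.+1) ?(@sexp_Xle _ m m.+1) //; last exact: constant_sX.
  by apply: eq_bigr => j _; rewrite [spow sX j.+1 _]smul_sX.
elim: n => [|n IHn]; apply: poly_deriv_inj; rewrite ?dE ?TmapX0 ?sexp_X0 //.
  by rewrite expr0 deriv_TmapX (TmapC 1) derivC subr0 /etx sexp_0.
(* With q = (1+u)^n, the relation T(uq)' = Tq - (Tq)' collapses T(q+uq) - T(q+uq)' to T(uq). *)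
rewrite deriv_TmapX IHn exprS mulrDl mul1r raddfD /= derivD deriv_TmapX.
by rewrite [_ + (_ - _)]addrC subrK [_ - _]addrAC subrr add0r.
Qed.

Lemma PhiE (p : {poly rat}) N : (size p <= N)%N -> Phi p = \sum_(j < N) p`_j * (j`!)%:R.
Proof.
move=> pN; rewrite /Phi (big_ord_widen N (fun j => p`_j * (j`!)%:R)) //.
rewrite big_mkcond; apply: eq_bigr => j _; case: ltnP => // nj.
by rewrite nth_default // mul0r.
Qed.

Lemma Phi_is_scalar : scalar Phi.
Proof.
move=> a p q; set N := maxn (size p) (size q).
rewrite !(@PhiE _ N) ?leq_maxl ?leq_maxr //; last first.
  rewrite (leq_trans (size_polyD _ _)) // geq_max leq_maxr andbT.
  by rewrite (leq_trans (size_scale_leq _ _)) // leq_maxl.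
rewrite mulr_sumr -big_split; apply: eq_bigr => j _ /=.
by rewrite coefD coefZ mulrDl mulrA.
Qed.
HB.instance Definition _ :=
  GRing.isLinear.Build rat {poly rat} rat *%R Phi Phi_is_scalar.

Lemma PhiC c : Phi c%:P = c.
Proof. by rewrite (@PhiE _ 1) ?size_polyC_leq1 // big_ord1 coefC mulr1. Qed.

(* Integration by parts in Phi p = int_0^oo p(t) e^-t dt. *)
Lemma Phi_deriv p : Phi p = p.[0] + Phi p^`().
Proof.
rewrite (@PhiE p (size p).+1) // (@PhiE p^`() (size p)); last first.
  by rewrite (leq_trans (size_poly _ _)) // leq_pred.
rewrite big_ord_recl mulr1 horner_coef0; congr (_ + _); apply: eq_bigr => j _.
by rewrite lift0 coef_deriv mulrnAl factS natrM mulrCA mulr_natl.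
Qed.

Lemma deriv_prod (I : finType) (F : I -> {poly rat}) :
  (\prod_i F i)^`() = \sum_i ((F i)^`() * \prod_(j | j != i) F j).
Proof.
(* Without repetitions in the list, the condition [j != i] removes exactly one factor. *)
suff H (r : seq I) : uniq r ->
    (\prod_(i <- r) F i)^`() = \sum_(i <- r) (F i)^`() * \prod_(j <- r | j != i) F j.
  by have := H _ (index_enum_uniq I).
elim: r => [|x r IHr]; first by rewrite !big_nil derivC.
move=> /= /andP[xr ur]; rewrite !big_cons eqxx derivM IHr // mulr_sumr; congr (_ + _).
  congr (_ * _); rewrite [LHS]big_seq [RHS]big_seq_cond; apply: eq_bigl => i.
  by case ir: (i \in r) => //=; apply/esym; apply: contraNneq xr => <-.
rewrite big_seq [RHS]big_seq; apply: eq_bigr => i ir.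
rewrite big_cons ifT; first by rewrite mulrCA.
by apply: contraNneq xr => ->.
Qed.

(** * Greedy pattern matching *)

(** Here [v] marks the positions of one letter in a word. Each block is sought after the end of the
    preceding one, and the default [false] keeps it inside the word. *)
Fixpoint occ (ms : seq nat) (v : seq bool) : Prop :=
  if ms is m :: ms' then
    exists2 p, (forall j, (j < m)%N -> nth false v (p + j)) & occ ms' (drop (p + m) v)
  else True.

(** The index tuple of [contains_pat] as a function on naturals, for a fixed letter. *)
Definition embeds (ms : seq nat) (v : seq bool) (f : nat -> nat) : Prop :=
  [/\ forall j, (j.+1 < sumn ms)%N -> (f j < f j.+1)%N,
      forall j, (j.+1 < sumn ms)%N -> j.+1 \notin block_bounds ms -> f j.+1 = (f j).+1
    & forall j, (j < sumn ms)%N -> nth false v (f j)].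

Lemma block_boundsE m ms b : 
  (b \in block_bounds (m :: ms)) =
  (b \in [seq (m + sumn (take r ms))%N | r <- iota 0 (size ms)]).
Proof.
rewrite /block_bounds /= (iotaDl 1 0) -map_comp; congr (_ \in _).
Qed.

Lemma block_bounds_lt m ms b : (b < m)%N -> b \notin block_bounds (m :: ms).
Proof.
by move=> bm; rewrite block_boundsE; apply/mapP => -[r _ e]; move: bm; lia.
Qed.

Lemma block_bounds_head m m' ms : m \in block_bounds [:: m, m' & ms].
Proof. by rewrite block_boundsE /= addn0 mem_head. Qed.

Lemma block_bounds_tail m ms b : all (fun m => 0 < m)%N ms -> (0 < b)%N ->
  (m + b \in block_bounds (m :: ms))%N = (b \in block_bounds ms).
Proof.
move=> ms0 b0; rewrite block_boundsE; case: ms ms0 => [|m' ms] //= /andP[m'0 _].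
rewrite addn0 in_cons [_ == m]eqn_leq.
have -> : (m + b <= m)%N = false by lia.
apply/mapP/mapP => -[r ri e]; exists r => //; first by move: e; lia.
by rewrite e.
Qed.

Lemma occ_drop ms n v : occ ms (drop n v) -> occ ms v.
Proof.
case: ms => [|m ms] //= [p pv oc]; exists (n + p)%N => [j jm|].
  by rewrite -addnA -nth_drop; exact: pv.
by rewrite -addnA addnC -drop_drop.
Qed.

Lemma occP ms v : all (fun m => 0 < m)%N ms -> occ ms v <-> exists f, embeds ms v f.
Proof.
elim: ms v => [|m ms IHms] v /= => [_|/andP[m0 ms0]].
  by split=> // _; exists id; split.
split.
  case=> p pv /(IHms _ ms0)[f [f1 f2 f3]].
  (* The first block sits at [p]; the embedding of the other blocks is shifted past it. *)
  exists (fun j => if (j < m)%N then (p + j)%N else (p + m + f (j - m))%N); split => j /= js.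
  - case: (ltnP j.+1 m) => jm; first by rewrite (ltnW jm); lia.
    case: (ltnP j m) => jm'; first by lia.
    by rewrite subSn // ltn_add2l f1 //; lia.
  - case: (ltnP j.+1 m) => jm jb; first by rewrite (ltnW jm); lia.
    case: (ltnP j m) => jm'.
      have em : j.+1 = m by lia.
      case: (ms) js jb => [|m' ms'] /=; first by lia.
      by rewrite em block_bounds_head.
    rewrite subSn // f2 ?addnS //; first by lia.
    rewrite -(block_bounds_tail m) //.
    by have -> : (m + (j - m).+1)%N = j.+1 by lia.
  - case: ltnP => jm; first exact: pv.
    by rewrite -nth_drop; apply: f3; lia.
case=> f [/= f1 f2 f3]; exists (f 0%N) => [j jm|].
  have -> : (f 0 + j)%N = f j; last by apply: f3; lia.
  elim: j jm => [|j IHj] jm; first by rewrite addn0.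
  rewrite f2 ?addnS ?IHj //; [exact: ltnW|by lia|exact: block_bounds_lt].
apply/(IHms _ ms0).
have fm j : (j < m)%N -> f j = (f 0 + j)%N.
  elim: j => [|j IHj] jm; first by rewrite addn0.
  by rewrite f2 ?addnS ?IHj //; [exact: ltnW|lia|exact: block_bounds_lt].
(* Later indices lie beyond the first block, so the subtraction in the next witness is exact. *)
have fge j : (j < sumn ms)%N -> (f 0 + m <= f (m + j))%N.
  elim: j => [|j IHj] js.
    have := f1 m.-1; rewrite addn0 prednK // fm ?prednK //; lia.
  rewrite addnS; apply: leq_trans (IHj (ltnW js)) (ltnW _); apply: f1; lia.
exists (fun j => f (m + j) - (f 0 + m))%N; split=> j js.
- by have := fge j (ltnW js); have := f1 (m + j)%N; rewrite addnS; lia.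
- move=> jb; have := fge j (ltnW js); rewrite addnS f2; first by lia.
    lia.
  by rewrite -addnS block_bounds_tail.
- by rewrite nth_drop subnKC ?fge //; apply: f3; lia.
Qed.

(** The common letter [x] is read off at the first index, which exists because the pattern is
    nonempty. *)
Lemma contains_occ (T : eqType) ms (w : seq T) : 
  (0 < size ms)%N -> all (fun m => 0 < m)%N ms ->
  contains_pat ms w <-> exists x, occ ms [seq y == x | y <- w].
Proof.
move=> s0 ms0; have S0 : (0 < sumn ms)%N.
  by case: ms s0 ms0 => //= m ms _ /andP[m0 _]; lia.
split.
  case/existsP => idx /and3P[srt /forallP eqs /forallP cons].
  pose s := [seq nat_of_ord i | i <- idx]; pose f := nth 0%N s.
  have ss : size s = sumn ms by rewrite size_map size_tuple.
  have fE (j : 'I_(sumn ms)) : f j = tnth idx j.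
    by rewrite /f (nth_map (tnth idx j)) ?size_tuple // -tnth_nth.
  pose x := tnth (in_tuple w) (tnth idx (Ordinal S0)).
  exists x; apply/occP => //; exists f; split => j js.
  - by have /(sortedP 0%N) := srt; apply; rewrite -/s ss.
  - move=> jb; have jlt := ltnW js; have := cons (Ordinal jlt).
    by rewrite /= js jb => /eqP.
  - rewrite (nth_map x); last by rewrite (fE (Ordinal js)).
    have /forallP/(_ (Ordinal S0)) := eqs (Ordinal js).
    by rewrite /= [X in X == _](tnth_nth x) -(fE (Ordinal js)).
case=> x /(occP _ ms0)[f [f1 f2 f3]].
have fw (j : 'I_(sumn ms)) : (f j < size w)%N.
  rewrite ltnNge; apply/negP => le.
  by have := f3 j (ltn_ord j); rewrite nth_default // size_map.
apply/existsP; exists [tuple Ordinal (fw j) | j < sumn ms].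
set s := [seq nat_of_ord i | i <- _].
have ss : size s = sumn ms by rewrite size_map size_tuple.
have sE j : (j < sumn ms)%N -> nth 0%N s j = f j.
  move=> js; have -> : nth 0%N s j = nth 0%N s (Ordinal js) by [].
  rewrite (nth_map (Ordinal (fw (Ordinal js)))) ?size_tuple //.
  by rewrite -tnth_nth tnth_mktuple.
apply/and3P; split.
- apply/(sortedP 0%N) => j; rewrite ss => js.
  by rewrite (sE _ js) (sE _ (ltnW js)); apply: f1.
- have wx j : tnth (in_tuple w) (Ordinal (fw j)) = x.
    have := f3 j (ltn_ord j); rewrite (nth_map x) // (tnth_nth x) /=.
    by move/eqP.
  by apply/forallP => i; apply/forallP => j; rewrite !tnth_mktuple !wx.
- apply/forallP => j; apply/implyP => /andP[js jb].
  by rewrite (sE _ js) (sE _ (ltn_ord j)) f2.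
Qed.

(* [c] counts the letters at the end of the current run that belong to no
   completed block; a flag [true] says that the letter starts a new run. *)
Fixpoint greedy (ms : seq nat) (c : nat) (bs : seq bool) {struct bs} : bool :=
  match ms, bs with
  | [::], _ => true
  | _, [::] => false
  | m :: ms', b :: bs' =>
     let c' := if b then 1%N else c.+1 in
     if c' == m then greedy ms' 0 bs' else greedy ms c' bs'
  end.

(** The option [o] holds the letter just before [w], or [None] at the beginning of a word. *)
Fixpoint run_flags (T : eqType) (x : T) (o : option T) (w : seq T) : seq bool :=
  if w is y :: w' then
    if y == x then (o != Some x) :: run_flags x (Some y) w' else run_flags x (Some y) w'
  else [::].

Lemma greedy_nil c bs : greedy [::] c bs. Proof. by case: bs. Qed.

(** Why greedy matching is optimal: wherever the first block is placed, it ends no earlier than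
    position [m], so the other blocks lie in [v]. *)
Lemma occ_cat_nseq m ms v : occ (m :: ms) (nseq m true ++ v) <-> occ ms v.
Proof.
split=> [[p _]|ov].
  by rewrite -drop_drop drop_size_cat ?size_nseq //; exact: occ_drop.
exists 0%N => [j jm|]; first by rewrite nth_cat size_nseq jm nth_nseq jm.
by rewrite drop_size_cat ?size_nseq.
Qed.

(** A block starting at or before the [false] would have to cover it, since [c < m]; so every
    placement starts beyond it. *)
Lemma occ_skip m ms c v : (c < m)%N ->
  occ (m :: ms) (nseq c true ++ false :: v) <-> occ (m :: ms) v.
Proof.
move=> cm; have -> : nseq c true ++ false :: v = rcons (nseq c true) false ++ v.
  by rewrite cat_rcons.
have sz : size (rcons (nseq c true) false) = c.+1 by rewrite size_rcons size_nseq.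
split=> [[p pv oc]|oc]; last first.
  by apply: (@occ_drop _ c.+1); rewrite drop_size_cat.
have cp : (c < p)%N.
  rewrite ltnNge; apply/negP => pc; have := pv (c - p)%N.
  rewrite subnKC // nth_cat sz ltnSn nth_rcons size_nseq ltnn eqxx.
  by move=> /(_ _)/notF; apply; lia.
exists (p - c.+1)%N => [j jm|].
  have := pv j jm; rewrite nth_cat sz ifF; last by lia.
  by have -> : (p + j - c.+1 = p - c.+1 + j)%N by lia.
move: oc; rewrite drop_cat sz ifF; last by lia.
by have -> : (p + m - c.+1 = p - c.+1 + m)%N by lia.
Qed.

(** Loop invariant of the matching: the pending letters of the current run are put back in front of
    the unread word. If the preceding letter is not [x], the counter is stale and stands for 0,
    since the next flag resets it. *)
Lemma occ_greedy (T : eqType) (x : T) w ms o c : all (fun m => 0 < m)%N ms ->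
  let c' := if o == Some x then c else 0%N in
  (c' < head c'.+1 ms)%N ->
  occ ms (nseq c' true ++ [seq y == x | y <- w]) <-> greedy ms c (run_flags x o w).
Proof.
move=> + c'; rewrite {}/c'.
elim: w ms o c => [|y w IHw] [|m ms] o c; rewrite ?greedy_nil //.
  move=> /andP[m0 ms0]; set c' := if _ then _ else _ => cm; split=> // -[p pv _].
  have := pv m.-1; rewrite cats0 nth_nseq; case: ifP => //; last by lia.
  by move: cm => /=; lia.
move=> ms0'; have /andP[m0 ms0] := ms0'.
set c' := if _ then _ else _ => cm.
rewrite [map _ _]/= [run_flags _ _ _]/=.
have [->|yx] := eqVneq y x; last first.
  apply: iff_trans (occ_skip _ _ cm) _.
  have := IHw (m :: ms) (Some y) c ms0'.
  have -> : (Some y == Some x) = false by apply/eqP => -[e]; rewrite e eqxx in yx.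
  by apply.
rewrite [greedy _ _ _]/=.
(* Whether or not the letter opens a run, the counter becomes one more than the number of pending
   letters. *)
have -> : (if o != Some x then 1%N else c.+1) = c'.+1 by rewrite /c' if_neg; case: ifP.
have -> : nseq c' true ++ true :: [seq y == x | y <- w] =
    nseq c'.+1 true ++ [seq y == x | y <- w].
  by elim: (c') => //= n ->.
case: eqP => [<-|/eqP ne].
  apply: iff_trans (occ_cat_nseq _ _ _) _.
  by have := IHw ms (Some x) 0%N ms0; rewrite eqxx; apply; case: (ms) ms0 => //= ? ? /andP[].
have := IHw (m :: ms) (Some x) c'.+1 ms0'; rewrite eqxx; apply.
by move: cm ne => /=; lia.
Qed.

(** * Counting words by flag strings *)

(* Sum of u^(number of runs) over the flag strings of length [a] in [Q]. *)
Fixpoint flags_poly (a : nat) (Q : seq bool -> bool) : {poly rat} :=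
  if a is a'.+1 then
    flags_poly a' (fun bs => Q (false :: bs)) + 'X * flags_poly a' (fun bs => Q (true :: bs))
  else (Q [::])%:R.

(* Only the strings opening a run count; the empty string is kept. *)
Definition fresh_poly (a : nat) (Q : seq bool -> bool) : {poly rat} :=
  if a is a'.+1 then 'X * flags_poly a' (fun bs => Q (true :: bs)) else (Q [::])%:R.

Lemma eq_flags_poly a (Q Q' : seq bool -> bool) : Q =1 Q' -> flags_poly a Q = flags_poly a Q'.
Proof.
elim: a Q Q' => [|a IHa] Q Q' e /=; first by rewrite e.
by congr (_ + _ * _); apply: IHa => bs; rewrite e.
Qed.

Lemma flags_polyN a (Q : seq bool -> bool) :
  flags_poly a (fun bs => ~~ Q bs) = (1 + 'X) ^+ a - flags_poly a Q.
Proof.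
elim: a Q => [|a IHa] Q /=; first by case: (Q [::]); rewrite ?subrr ?subr0.
rewrite !IHa exprS mulrDl mul1r mulrBr opprD addrACA //.
Qed.

Section CountWords.
Variable I : finType.
Implicit Types (al : I -> nat) (o : option I) (Q : I -> seq bool -> bool).

Fixpoint word_sum (n : nat) (F : seq I -> rat) : rat :=
  if n is n'.+1 then \sum_(y : I) word_sum n' (fun w => F (y :: w)) else F [::].

Lemma word_sumE n (F : seq I -> rat) : \sum_(w : n.-tuple I) F w = word_sum n F.
Proof.
elim: n F => [|n IHn] F /=.
  rewrite (big_pred1 [tuple]) // => w.
  by rewrite [w]tuple0 /= eqxx.
under [RHS]eq_bigr do rewrite -IHn.
rewrite pair_big /= (reindex (fun p : I * n.-tuple I => [tuple of p.1 :: p.2])) /=; first by [].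
exists (fun w : n.+1.-tuple I => (thead w, [tuple of behead w])) => [[y w] _|w _] /=.
  by congr (_, _); apply: val_inj.
by rewrite [RHS]tuple_eta; apply: val_inj.
Qed.

Lemma eq_word_sum n (F F' : seq I -> rat) : F =1 F' -> word_sum n F = word_sum n F'.
Proof.
by elim: n F F' => [|n IHn] F F' e /=; [|apply: eq_bigr => y _; apply: IHn => w]; rewrite e.
Qed.

Lemma word_sum0 n : word_sum n (fun=> 0) = 0.
Proof. by elim: n => //= n IHn; rewrite big1. Qed.

Definition good_word al o Q (w : seq I) :=
  [forall i, (count_mem i w == al i) && Q i (run_flags i o w)].

(** Reading [y] passes its flag on to the condition of [y]; the recursion closes because the
    conditions are arbitrary predicates. *)
Lemma good_word_cons al o Q y w :
  good_word al o Q (y :: w) =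
  (0 < al y)%N && good_word (fun i => al i - (i == y))%N (Some y)
    (fun i bs => Q i (if i == y then (o != Some y) :: bs else bs)) w.
Proof.
apply/forallP/andP => [H|[aly /forallP H] i].
  split; first by have /andP[/eqP <- _] := H y; rewrite /= eqxx.
  apply/forallP => i; have /andP[/eqP <-] := H i.
  rewrite /= [y == i]eq_sym; have [->|_] := eqVneq i y; last by rewrite subn0 eqxx.
  by rewrite add1n subn1 eqxx.
have /= := H i; rewrite [y == i]eq_sym; have [->|_] := eqVneq i y; last by rewrite subn0.
by rewrite subn1 add1n => /andP[/eqP -> ->]; rewrite prednK // eqxx.
Qed.

Definition letter_poly o al Q i : {poly rat} :=
  if o == Some i then Tmap (flags_poly (al i) (Q i)) - (Tmap (flags_poly (al i) (Q i)))^`()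
  else Tmap (fresh_poly (al i) (Q i)).

(** The factor of letter [i] once an occurrence of it with flag [b] has been read; it is 0 when none
    remains. *)
Definition step_poly al Q b i : {poly rat} :=
  if al i is a.+1 then
    let p := Tmap (flags_poly a (fun bs => Q i (b :: bs))) in p - p^`()
  else 0.

Lemma Tmap_bool (b : bool) : Tmap b%:R = b%:R.
Proof. by rewrite -polyC_natr TmapC. Qed.

Lemma deriv_fresh al Q i :
  (Tmap (fresh_poly (al i) (Q i)))^`() = step_poly al Q true i.
Proof.
rewrite /step_poly; case: (al i) => [|a] /=; last exact: deriv_TmapX.
by rewrite Tmap_bool -polyC_natr derivC.
Qed.

(** Split by the first flag: the strings opening a run give T(uB) - T(uB)', whose derivative term is
    the step with flag [true]. *)
Lemma flags_poly_split al Q i :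
  Tmap (flags_poly (al i) (Q i)) - (Tmap (flags_poly (al i) (Q i)))^`() =
  Tmap (fresh_poly (al i) (Q i)) - step_poly al Q true i + step_poly al Q false i.
Proof.
rewrite /step_poly; case: (al i) => [|a] /=.
  by rewrite Tmap_bool -polyC_natr derivC subr0 addr0.
by rewrite raddfD /= derivD -deriv_TmapX opprD addrACA addrC.
Qed.

(** The factor of [i0] vanishes at t = 0, so integration by parts leaves only the derivative, and
    the Leibniz rule sums over the first letter. *)
Lemma Phi_fresh al Q i0 : (0 < al i0)%N ->
  Phi (\prod_i Tmap (fresh_poly (al i) (Q i))) =
  \sum_i Phi (step_poly al Q true i * \prod_(j | j != i) Tmap (fresh_poly (al j) (Q j))).
Proof.
move=> al0; rewrite Phi_deriv deriv_prod raddf_sum /=.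
rewrite (bigD1 i0) //= hornerM; case: (al i0) al0 => //= a _.
rewrite TmapX0 mul0r add0r; apply: eq_bigr => i _.
by rewrite deriv_fresh.
Qed.

Lemma count_words n o al Q : (\sum_i al i)%N = n ->
  word_sum n (fun w => (good_word al o Q w)%:R) = Phi (\prod_i letter_poly o al Q i).
Proof.
elim: n o al Q => [|n IHn] o al Q aln.
  have al0 i : al i = 0%N.
    by apply/eqP; move/eqP: aln; rewrite sum_nat_eq0 => /forallP/(_ i).
  have -> : \prod_i letter_poly o al Q i = (\prod_i (Q i [::])%:R)%:P.
    rewrite rmorph_prod /=; apply: eq_bigr => i _.
    rewrite /letter_poly al0 /= Tmap_bool -polyC_natr derivC subr0.
    by rewrite if_same.
  rewrite PhiC /=; case: (boolP (good_word _ _ _ _)) => [/forallP H|/forallPn[i]].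
    by rewrite big1 // => i _; have /andP[_ /= ->] := H i.
  by rewrite al0 /= => /negbTE Qi; rewrite (bigD1 i) //= Qi mul0r.
(* Once a letter has been read, every other letter must open a run at its next occurrence. *)
pose R i := \prod_(j | j != i) Tmap (fresh_poly (al j) (Q j)).
have -> : word_sum n.+1 (fun w => (good_word al o Q w)%:R) =
    \sum_y Phi (step_poly al Q (o != Some y) y * R y).
  apply: eq_bigr => y _.
  transitivity (word_sum n (fun w => ((0 < al y)%N &&
      good_word (fun i => al i - (i == y))%N (Some y)
        (fun i bs => Q i (if i == y then (o != Some y) :: bs else bs)) w)%:R)).
    by apply: eq_word_sum => w; rewrite good_word_cons.
  case: (posnP (al y)) => [al0|aly].
    have -> : step_poly al Q (o != Some y) y = 0 by rewrite /step_poly al0.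
    rewrite mul0r -polyC0 PhiC -[RHS](word_sum0 n); exact: eq_word_sum.
  rewrite /= IHn; last first.
    rewrite (bigD1 y) //= eqxx subn1 (eq_bigr al) => [|i /negbTE ->]; last by rewrite subn0.
    by have := aln; rewrite (bigD1 y) //=; lia.
  congr Phi; rewrite (bigD1 y) //=; congr (_ * _).
    rewrite /letter_poly /step_poly eqxx subn1; case: (al y) aly => //= a _.
    by rewrite eqxx.
  apply: eq_bigr => i iy; rewrite /letter_poly ifF; last first.
    by apply/eqP => -[e]; rewrite e eqxx in iy.
  by rewrite (negbTE iy) subn0.
have [i0 ali0] : exists i, (0 < al i)%N.
  apply/existsP; rewrite -[X in is_true X]negbK negb_exists; apply/negP => /forallP al0.
  by rewrite big1 // in aln => i _; have := al0 i; rewrite -eqn0Ngt => /eqP.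
case: o => [j|]; last first.
  by rewrite (@Phi_fresh _ _ i0).
(* Compared with an initial position, only the step for [j] changes: it continues a run instead of
   opening one. *)
have -> : \prod_i letter_poly (Some j) al Q i =
   \prod_i Tmap (fresh_poly (al i) (Q i)) - step_poly al Q true j * R j + step_poly al Q false j * R j.
  rewrite (bigD1 j) //= [in RHS](bigD1 j) //= -mulrBl -mulrDl -flags_poly_split.
  rewrite /letter_poly eqxx; congr (_ * _); apply: eq_bigr => i ij.
  by rewrite ifF //; apply/eqP => -[e]; rewrite e eqxx in ij.
rewrite raddfD raddfB /= (@Phi_fresh _ _ i0) // (bigD1 j) //= [in RHS](bigD1 j) //=.
rewrite eqxx /= [RHS]addrC; congr (_ + _); rewrite addrAC subrr add0r.
apply: eq_bigr => i ij; congr (Phi (step_poly _ _ _ _ * _)).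
by apply/eqP => -[e]; rewrite e eqxx in ij.
Qed.
End CountWords.

(** * The series of matching flag strings *)

Section MatchingSeries.
(* [ring] matches the structure syntactically, so the canonical instance must
   not be hidden behind [reverse_coercion]. *)
Definition poly_series_theory :=
  Eval unfold reverse_coercion in series_ring_theory ({poly rat} : comNzRingType).
Definition poly_series_equiv :=
  Eval unfold reverse_coercion in series_eq_equiv ({poly rat} : comNzRingType).
Definition poly_series_ext :=
  Eval unfold reverse_coercion in series_eq_ext ({poly rat} : comNzRingType).
Add Ring series_ring : poly_series_theory
  (setoid poly_series_equiv poly_series_ext).

#[local] Existing Instance poly_series_equiv.
#[local] Instance sadd_proper : Proper (@series_eq _ ==> @series_eq _ ==> @series_eq _) (@sadd _) :=
  Radd_ext poly_series_ext.
#[local] Instance smul_proper : Proper (@series_eq _ ==> @series_eq _ ==> @series_eq _) (@smul _) :=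
  Rmul_ext poly_series_ext.
#[local] Instance ssub_proper (R : comNzRingType) :
  Proper (@series_eq R ==> @series_eq R ==> @series_eq R) (@ssub R).
Proof. by move=> f f' ef g g' eg n; rewrite /ssub ef eg. Qed.

Implicit Types f g : nat -> {poly rat}.
Notation "f ~ g" := (series_eq f g) (at level 70).

Definition flags_series ms c : nat -> {poly rat} := fun a => flags_poly a (greedy ms c).

(* The series after the greedy matching has set its counter to [c]: the block
   [m] is complete when [c = m]. *)
Definition next_series m ms c := if c == m then flags_series ms 0 else flags_series (m :: ms) c.

(** The first flag either advances the counter or, at the cost of a factor u, resets it to 1. *)
Lemma flags_seriesE m ms c :
  flags_series (m :: ms) c ~
  sadd (smul sX (next_series m ms c.+1)) (smul sU (smul sX (next_series m ms 1%N))).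
Proof.
move=> [|a]; rewrite /sadd /sU smul_sconst !smul_sX ?mulr0 ?addr0 //=.
rewrite /flags_series /=; congr (_ + _ * _); rewrite /next_series; case: ifP => e;
  by apply: eq_flags_poly => bs /=; rewrite ?e.
Qed.

Lemma flags_series_nil c : smul denB (flags_series [::] c) ~ sone.
Proof.
set F := flags_series _ _; move=> n.
have -> : smul denB F ~ ssub F (sadd (smul sX F) (smul sU (smul sX F))).
  rewrite /denB; ring.
rewrite /ssub /sadd /sU smul_sconst !smul_sX; case: n => [|n].
  by rewrite mulr0 addr0 subr0.
rewrite /F /flags_series /=.
by rewrite !(@eq_flags_poly _ _ (greedy [::] c)) ?subrr // => bs; rewrite greedy_nil.
Qed.

Lemma sXn0 (R : comNzRingType) : @series_eq R (sXn 0) sone.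
Proof. by []. Qed.

Lemma sXnS (R : comNzRingType) n : @series_eq R (sXn n.+1) (smul sX (sXn n)).
Proof. by case=> [|m]; rewrite smul_sX. Qed.

(** Writing N_c for the series at counter c, this solves N_c = x N_(c+1) + u x N_1 downward from c =
    m; the factor 1-x sums the geometric progression. *)
Lemma next_seriesE m ms n : (n <= m)%N ->
  smul (ssub sone sX) (next_series m ms (m - n)%N) ~
  sadd (smul (smul (ssub sone sX) (sXn n)) (flags_series ms 0))
       (smul (smul sU (ssub sX (smul sX (sXn n)))) (next_series m ms 1%N)).
Proof.
elim: n => [|n IHn] nm.
  rewrite subn0 /next_series eqxx -/(next_series m ms 1%N).
  rewrite sXn0.
  ring.
have e := IHn (ltnW nm).
have -> : next_series m ms (m - n.+1)%N ~
    sadd (smul sX (next_series m ms (m - n)%N)) (smul sU (smul sX (next_series m ms 1%N))).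
  rewrite {1}/next_series ifF; last by lia.
  rewrite flags_seriesE.
  by have -> : ((m - n.+1).+1 = m - n)%N by lia.
transitivity (sadd (smul sX (smul (ssub sone sX) (next_series m ms (m - n)%N)))
  (smul (ssub sone sX) (smul sU (smul sX (next_series m ms 1%N))))).
  ring.
rewrite e (sXnS _ n); ring.
Qed.

(** The case n = m-1 becomes an equation for N_1 alone, and collecting its terms produces
    [denA m]. *)
Lemma next_series1 m ms : (0 < m)%N ->
  smul (denA m) (next_series m ms 1%N) ~
  smul (smul (ssub sone sX) (sXn m.-1)) (flags_series ms 0).
Proof.
case: m => // m _; have e := next_seriesE ms (leqnSn m); rewrite subSnn in e.
transitivity (ssub (smul (ssub sone sX) (next_series m.+1 ms 1%N))
  (smul (smul sU (ssub sX (sXn m.+1))) (next_series m.+1 ms 1%N))).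
  rewrite /denA; ring.
rewrite e (sXnS _ m) /=; ring.
Qed.

Lemma denA_sinv m : (0 < m)%N -> smul (denA m) (sinv (denA m)) ~ sone.
Proof.
move=> m0; apply: smul_sinv.
rewrite /denA /ssub /sU smul_sconst /sone /sX /sXn eqxx /=.
by rewrite eq_sym (gtn_eqF m0) !subr0 mulr0 subr0.
Qed.

Lemma denB_sinv : smul denB (sinv denB) ~ sone.
Proof.
apply: smul_sinv; rewrite /denB /ssub /sU smul_sconst /sone /sX /=.
by rewrite mulr0 !subr0.
Qed.

(** From counter 0 either flag leads to counter 1, giving (1+u) x N_1. This agrees with [Gfactor]
    because [denA m] + u(1-x^m) = (1+u)(1-x). *)
Lemma flags_series_cons m ms : (0 < m)%N ->
  flags_series (m :: ms) 0 ~ smul (Gfactor m) (flags_series ms 0).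
Proof.
move=> m0; have ei := denA_sinv m0; have e1 := next_series1 ms m0.
case: m m0 => // m _ in ei e1 *; rewrite /= in e1.
rewrite flags_seriesE.
set K := next_series _ _ _ in e1 *.
set J := sinv (denA _) in ei *.
transitivity (smul (smul (sadd sX (smul sU sX)) K) sone); first by ring.
rewrite -ei.
transitivity (smul (smul (sadd sX (smul sU sX)) J) (smul (denA m.+1) K)); first by ring.
rewrite e1 /Gfactor -/J.
transitivity (smul (sadd (smul (sXn m.+1) (smul (denA m.+1) J))
   (smul (smul (smul sU (sXn m.+1)) (ssub sone (sXn m.+1))) J)) (flags_series ms 0)); last first.
  by rewrite ei; ring.
rewrite /denA (sXnS _ m); ring.
Qed.

Lemma flags_series_sprod ms : all (fun m => 0 < m)%N ms ->
  flags_series ms 0 ~ smul (sinv denB) (sprod [seq Gfactor m | m <- ms]).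
Proof.
elim: ms => [_|m ms IHms /= /andP[m0 ms0]] /=.
  transitivity (smul (smul denB (flags_series [::] 0)) (sinv denB)).
    transitivity (smul (smul denB (sinv denB)) (flags_series [::] 0)); last by ring.
    by rewrite denB_sinv; symmetry; ring.
  by rewrite flags_series_nil; ring.
rewrite flags_series_cons // IHms //; ring.
Qed.

(** The first occurrence of a letter opens a run, so the first block contributes u x N_1 instead of
    (1+u) x N_1; hence the special first factor of G. *)
Lemma GtauE ms : (0 < size ms)%N -> all (fun m => 0 < m)%N ms ->
  Gtau ms ~ (fun a => fresh_poly a (greedy ms 0)).
Proof.
case: ms => //= m ms _ /andP[m0 ms0].
have fE : smul sU (smul sX (next_series m ms 1%N)) ~ (fun a => fresh_poly a (greedy (m :: ms) 0)).
  move=> a; rewrite /sU smul_sconst smul_sX; case: a => [|a] /=; first by rewrite mulr0.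
  congr (_ * _); rewrite /flags_series /next_series; case: ifP => e;
  by apply: eq_flags_poly => bs /=; rewrite ?e.
rewrite -fE => {fE}.
have ei := denA_sinv m0; have e1 := next_series1 ms m0.
have eh := flags_series_sprod ms0.
case: m m0 => // m _ in ei e1 *; rewrite /= in e1.
set K := next_series _ _ _ in e1 *.
transitivity (smul (smul (smul sU sX) K) (smul (denA m.+1) (sinv (denA m.+1)))); last first.
  by rewrite ei; ring.
transitivity (smul (smul (smul sU sX) (sinv (denA m.+1))) (smul (denA m.+1) K)); last by ring.
rewrite e1 eh (sXnS _ m); ring.
Qed.
End MatchingSeries.

(** * The generating function, compared monomial by monomial *)

Theorem theorem4p1 (k : nat) (ms : seq nat) :
  (0 < k)%N -> (0 < size ms)%N -> all (fun m => 0 < m)%N ms ->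
  forall al : 'I_k -> nat,
    (#|[set w : (\sum_(i < k) al i)%N.-tuple 'I_k |
          avoids_pat ms w && [forall i, count_mem i w == al i]]|)%:R
    = Phi (\prod_(i < k) Ffactor ms (al i)) :> rat.
Proof.
move=> _ s0 ms0 al.
pose Q (i : 'I_k) bs := ~~ greedy ms 0 bs.
(* Subtracting the matched strings from all strings that open a run leaves the unmatched ones; with
   no preceding letter every factor has this form. *)
have -> : \prod_(i < k) Ffactor ms (al i) = \prod_(i < k) letter_poly None al Q i.
  apply: eq_bigr => i _; rewrite /letter_poly /Ffactor GtauE //=.
  case: (al i) => [|a] /=; last first.
    by rewrite etxE /Q flags_polyN mulrBr raddfB.
  by rewrite /etx sexp_0 !Tmap_bool /Q; case: (ms) => [|? ?]; rewrite ?subrr ?subr0.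
rewrite -(@count_words _ _ None al Q erefl) -word_sumE -sum1_card natr_sum big_mkcond /=.
apply: eq_bigr => w _; rewrite inE.
have -> : avoids_pat ms w && [forall i, count_mem i w == al i] = good_word al None Q w.
  apply/andP/forallP => [[av /forallP ct] i|H].
    rewrite ct; apply: contra av => acc.
    (* Nothing precedes the word, so the invariant starts with no pending letters. *)
    have oc : occ ms [seq y == i | y <- w].
      by apply/(@occ_greedy _ i w ms None 0%N ms0) => //; case: (ms) s0 ms0 => //= m ? _ /andP[].
    by apply/(contains_occ _ s0 ms0); exists i.
  split; last by apply/forallP => i; have /andP[] := H i.
  apply/negP => /(contains_occ _ s0 ms0)[i oc].
  have /andP[_ /negP] := H i; apply.
  by apply/(@occ_greedy _ i w ms None 0%N ms0) => //; case: (ms) s0 ms0 => //= m ? _ /andP[].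
by case: (good_word al None Q w).
Qed.
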